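(* Let $q\in\mathbb{D}$ and $\mu_1,\mu_2\in\mathbb{C}$ with $|\mu_1|=|\mu_2|=1$, and let $$\varphi(z)=\mu_1\frac{q-z}{1-\overline{q}z},\qquad \psi(z)=\mu_2\frac{\sqrt{1-|q|^2}}{1-\overline{q}z}.$$ Then the unitary weighted composition operator $W_{\psi,\varphi}$ on $H^2(\mathbb{D})$ is complex symmetric with conjugation $\mathcal{J}W_{k_{\overline{q}},\sigma}$, where $$k_{\overline{q}}(z)=\frac{\sqrt{1-|q|^2}}{1-qz},\qquad \sigma(z)=\lambda\frac{\overline{q}-z}{1-qz},$$ with $\lambda=q/\overline{q}$ if $q\neq0$ and $\lambda$ any unimodular constant if $q=0$.
   Context: $\mathbb{D}$ is the open unit disk in $\mathbb{C}$; $H^2(\mathbb{D})$ is the classical Hardy–Hilbert space on $\mathbb{D}$. For $\psi$ holomorphic on $\mathbb{D}$ and $\varphi$ a holomorphic self-map of $\mathbb{D}$, the weighted composition operator is $W_{\psi,\varphi}f=\psi\cdot(f\circ\varphi)$. A conjugation on a complex Hilbert space is an anti-linear, isometric map $\mathcal{C}$ with $\mathcal{C}^2=I$. A bounded operator $T$ is complex symmetric with conjugation $\mathcal{C}$ if $\mathcal{C}T=T^*\mathcal{C}$. $\mathcal{J}$ is the conjugation on $H^2(\mathbb{D})$ given by $\mathcal{J}(\sum_{n\ge0}a_nz^n)=\sum_{n\ge0}\overline{a_n}z^n$. *)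

(* Defs.v *)
(* Functions on the open unit disk D are represented by functions [C -> C] of
   which only the values on D matter; equality of two such functions is [eqD].
   An operator on H^2(D) is accordingly a map [(C -> C) -> (C -> C)] of which
   only the action on elements of H^2(D), up to [eqD], matters. *)

From Stdlib Require Import Reals ClassicalEpsilon.
From Coquelicot Require Export Coquelicot.

Open Scope C_scope.

Definition in_disk (z : C) : Prop := (Cmod z < 1)%R.

Definition eqD (f g : C -> C) : Prop := forall z : C, in_disk z -> f z = g z.

Definition holomorphic_on_disk (f : C -> C) : Prop :=
  forall z : C, in_disk z -> @ex_derive C_AbsRing C_NormedModule f z.

Definition holomorphic_self_map (phi : C -> C) : Prop :=
  holomorphic_on_disk phi /\ forall z : C, in_disk z -> in_disk (phi z).

Definition has_taylor (f : C -> C) (a : nat -> C) : Prop :=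
  forall z : C, in_disk z -> @is_pseries C_AbsRing C_NormedModule a z (f z).

Definition square_summable (a : nat -> C) : Prop :=
  ex_series (fun n : nat => (Cmod (a n) ^ 2)%R).

(* Membership in H^2(D); holomorphy on D is part of [has_taylor]. *)
Definition H2 (f : C -> C) : Prop :=
  exists a : nat -> C, square_summable a /\ has_taylor f a.

(* The Taylor coefficients of [f] at 0 (arbitrary if [f] is not the sum of a
   power series on D); they are unique when they exist. *)
Definition taylor (f : C -> C) : nat -> C :=
  epsilon (inhabits (fun _ : nat => RtoC 0)) (has_taylor f).

Definition CSeries (u : nat -> C) : C :=
  (Series (fun n : nat => Re (u n)), Series (fun n : nat => Im (u n))).

(* Linear in the first argument. *)
Definition inner (f g : C -> C) : C :=
  CSeries (fun n : nat => taylor f n * Cconj (taylor g n)).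

Definition norm2 (f : C -> C) : R := sqrt (Re (inner f f)).

Definition operator : Type := (C -> C) -> (C -> C).

Definition maps_H2 (T : operator) : Prop :=
  forall f : C -> C, H2 f -> H2 (T f).

Definition linear_on_H2 (T : operator) : Prop :=
  forall (a b : C) (f g : C -> C), H2 f -> H2 g ->
    eqD (T (fun z => a * f z + b * g z)) (fun z => a * T f z + b * T g z).

Definition antilinear_on_H2 (T : operator) : Prop :=
  forall (a b : C) (f g : C -> C), H2 f -> H2 g ->
    eqD (T (fun z => a * f z + b * g z))
        (fun z => Cconj a * T f z + Cconj b * T g z).

(* The norm bound also makes [T] compatible with [eqD]. *)
Definition bounded_operator (T : operator) : Prop :=
  maps_H2 T /\ linear_on_H2 T /\
  exists M : R, forall f : C -> C, H2 f -> (norm2 (T f) <= M * norm2 f)%R.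

(* [S] is the adjoint T^* (unique on H^2(D) up to [eqD]). *)
Definition is_adjoint (T S : operator) : Prop :=
  bounded_operator S /\
  forall f g : C -> C, H2 f -> H2 g -> inner (T f) g = inner f (S g).

Definition unitary_operator (T : operator) : Prop :=
  bounded_operator T /\
  exists S : operator, is_adjoint T S /\
    forall f : C -> C, H2 f -> eqD (S (T f)) f /\ eqD (T (S f)) f.

Definition conjugation (K : operator) : Prop :=
  maps_H2 K /\ antilinear_on_H2 K /\
  (forall f : C -> C, H2 f -> norm2 (K f) = norm2 f) /\
  (forall f : C -> C, H2 f -> eqD (K (K f)) f).

(* [T] is bounded, [K] is a conjugation, and K T = T^* K. *)
Definition complex_symmetric_with (T K : operator) : Prop :=
  bounded_operator T /\ conjugation K /\
  exists S : operator, is_adjoint T S /\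
    forall f : C -> C, H2 f -> eqD (K (T f)) (S (K f)).

Definition wcomp (psi phi : C -> C) : operator :=
  fun f z => psi z * f (phi z).

Definition J : operator :=
  fun f z => CSeries (fun n : nat => Cconj (taylor f n) * z ^ n).

(* Main.v *)
Require Import Defs.
From Stdlib Require Import Reals.
From Coquelicot Require Import Coquelicot.
From Stdlib Require Import Lra Lia FunctionalExtensionality ClassicalEpsilon.
Open Scope C_scope.

(** Write [W(q, mu, c)] for the operator with weight [kern q c] and symbol
    [mobius q mu], where [|q| < 1] and [|mu| = |c| = 1]. Both operators of the
    theorem are of this form: [T = W(q, mu1, mu2)] and
    [W = W(conj q, lambda, 1)].

    The analytic core is that [W(q, mu, c)] maps H^2 contractively into itself.
    The Blaschke factor [(z - q) / (1 - conj q z)] is the transfer function of a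
    unitary 2 x 2 matrix. Composing a power series with it amounts to running an
    infinite cascade of such cells whose initial states are the coefficients of
    the series; the signals leaving the cascade are the Taylor coefficients of
    the weighted composition ([output_transfer]). Every cell preserves energy,
    so the emitted signals have at most the energy of the initial states
    ([output_energy]).

    The rest is algebra. By [kern_mobius_comp],
    [W(b, m2, c1) W(m2 b, m1, c2)] is the rotation [f |-> c1 c2 f(m1 m2 z)]. So
    [W(q, mu, c)] has the inverse [W(mu q, conj mu, conj c)], again a
    contraction; both are then isometries, and by polarization the inverse is
    the adjoint ([wcomp_unitary]).

    On H^2 the map [J] is [f |-> conj (f (conj z))], which conjugates the
    parameters of an operator of the family. The condition on [lambda] amounts
    to [|lambda| = 1] and [lambda * conj q = q], including the case [q = 0], and
    it makes [J W J] equal to the inverse of [W]. Hence [J W] is a conjugation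
    ([J_wcomp_conjugation]). Finally [W T] and [T^-1 (J W J)] are rotations that
    correspond under [J], which gives [J W T = T^-1 J W]
    ([wcomp_J_symmetry]). *)

Notation Csum := (@is_series C_AbsRing C_NormedModule).

(** * Series and power series of complex numbers *)

Lemma Cmod_sq (z : C) : (Cmod z ^ 2 = Re z ^ 2 + Im z ^ 2)%R.
Proof.
  unfold Cmod. rewrite pow2_sqrt; [reflexivity|].
  apply Rplus_le_le_0_compat; apply pow2_ge_0.
Qed.

Lemma pow_n_Cpow (z : C) (n : nat) : @pow_n C_Ring z n = z ^ n.
Proof. induction n as [|n IH]; simpl; [reflexivity|now rewrite IH]. Qed.

Lemma sum_n_C (u : nat -> C) (n : nat) :
  @sum_n C_AbelianMonoid u n
  = (sum_n (fun k => Re (u k)) n, sum_n (fun k => Im (u k)) n).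
Proof.
  induction n as [|n IH].
  - rewrite !sum_O. apply surjective_pairing.
  - rewrite !sum_Sn, IH. reflexivity.
Qed.

(** The topology on [C] is the product topology of [R * R], so convergence is
    convergence of both parts; this ties [CSeries], which is built from two
    real series, to convergence in the complex normed module. *)
Lemma is_series_C (u : nat -> C) (l : C) :
  Csum u l <->
  is_series (fun n => Re (u n)) (Re l) /\ is_series (fun n => Im (u n)) (Im l).
Proof.
  unfold is_series. split.
  - intros H; split.
    + apply (filterlim_ext (fun n => fst (@sum_n C_AbelianMonoid u n))).
      { intros n. now rewrite sum_n_C. }
      intros P [e He]. destruct (H (fun z => P (fst z))) as [N HN].
      { exists e. intros y Hy. apply He, Hy. }
      exists N. exact HN.
    + apply (filterlim_ext (fun n => snd (@sum_n C_AbelianMonoid u n))).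
      { intros n. now rewrite sum_n_C. }
      intros P [e He]. destruct (H (fun z => P (snd z))) as [N HN].
      { exists e. intros y Hy. apply He, Hy. }
      exists N. exact HN.
  - intros [H1 H2] P [e He].
    destruct (H1 (ball (Re l) e)) as [N1 HN1]; [apply locally_ball|].
    destruct (H2 (ball (Im l) e)) as [N2 HN2]; [apply locally_ball|].
    exists (max N1 N2). intros n Hn. apply He. rewrite sum_n_C. split.
    + apply HN1. lia.
    + apply HN2. lia.
Qed.

Lemma CSeries_unique (u : nat -> C) (l : C) : Csum u l -> CSeries u = l.
Proof.
  intros H. apply is_series_C in H. destruct H as [H1 H2]. unfold CSeries.
  rewrite (is_series_unique _ _ H1), (is_series_unique _ _ H2).
  symmetry. apply surjective_pairing.
Qed.

Lemma Csum_unique (u : nat -> C) (l l' : C) : Csum u l -> Csum u l' -> l = l'.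
Proof.
  intros H H'. rewrite <- (CSeries_unique _ _ H). now apply CSeries_unique.
Qed.

Lemma Csum_ext (u v : nat -> C) (l : C) :
  (forall n, u n = v n) -> Csum u l -> Csum v l.
Proof. intros H. now apply is_series_ext. Qed.

Lemma Csum_plus (u v : nat -> C) (l m : C) :
  Csum u l -> Csum v m -> Csum (fun n => u n + v n) (l + m).
Proof. apply (@is_series_plus C_AbsRing C_NormedModule). Qed.

Lemma Csum_scal (c : C) (u : nat -> C) (l : C) :
  Csum u l -> Csum (fun n => c * u n) (c * l).
Proof. apply (@is_series_scal C_AbsRing C_NormedModule). Qed.

Lemma Csum_conj (u : nat -> C) (l : C) :
  Csum u l -> Csum (fun n => Cconj (u n)) (Cconj l).
Proof.
  intros H. apply is_series_C in H. destruct H as [H1 H2].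
  apply is_series_C. split; [exact H1|]. simpl.
  exact (is_series_opp _ _ H2).
Qed.

Lemma Csum_incr_1 (u : nat -> C) (l : C) :
  Csum u l -> Csum (fun n => u (S n)) (l - u 0%nat).
Proof.
  intros H. apply (@is_series_incr_1 C_AbsRing C_NormedModule).
  assert (E : l = (l - u 0%nat) + u 0%nat) by ring.
  rewrite E in H. exact H.
Qed.

Lemma Cmod_sum_n_le (u : nat -> C) (b : nat -> R) :
  (forall n, (Cmod (u n) <= b n)%R) ->
  forall n, (Cmod (@sum_n C_AbelianMonoid u n) <= sum_n b n)%R.
Proof.
  intros H n. induction n as [|n IH].
  - rewrite !sum_O. apply H.
  - rewrite !sum_Sn. eapply Rle_trans; [apply Cmod_triangle|].
    apply Rplus_le_compat; [exact IH|apply H].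
Qed.

Lemma Csum_dominated (u : nat -> C) (b : nat -> R) (B : R) :
  (forall n, (Cmod (u n) <= b n)%R) -> is_series b B ->
  Csum u (CSeries u) /\ (Cmod (CSeries u) <= B)%R.
Proof.
  intros Hu Hb.
  destruct (@ex_series_le C_AbsRing C_CompleteNormedModule u b) as [l Hl].
  { exact Hu. }
  { now exists B. }
  change (Csum u l) in Hl.
  rewrite (CSeries_unique u l Hl). split; [exact Hl|].
  assert (HL : is_lim_seq (fun n => Cmod (@sum_n C_AbelianMonoid u n)) (Cmod l)).
  { exact (filterlim_comp _ _ _ _ _ _ _ _ Hl
             (@filterlim_norm C_AbsRing C_NormedModule l)). }
  exact (is_lim_seq_le _ _ (Cmod l) B (Cmod_sum_n_le u b Hu) HL Hb).
Qed.

Lemma Csum_geometric_bound (r : R) (u : nat -> C) (B : R) :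
  (0 <= r < 1)%R -> (forall n, (Cmod (u n) <= r ^ n * B)%R) ->
  Csum u (CSeries u) /\ (Cmod (CSeries u) <= / (1 - r) * B)%R.
Proof.
  intros Hr Hu.
  apply Csum_dominated with (b := fun n => (r ^ n * B)%R); [exact Hu|].
  apply (is_series_scal_r B), is_series_geom.
  rewrite Rabs_pos_eq; apply Hr.
Qed.

(** Used where a recursion unrolled [n] times leaves an explicit remainder: it
    gives both the convergence and the value of the sum. *)
Lemma Csum_of_remainder (u : nat -> C) (l : C) (e : nat -> R) :
  (forall n, (Cmod (l - @sum_n C_AbelianMonoid u n) <= e n)%R) ->
  is_lim_seq e 0%R -> Csum u l.
Proof.
  intros Hu He.
  refine (proj2 (@filterlim_locally_ball_norm C_AbsRing nat C_NormedModule
                   eventually _ (@sum_n C_AbelianMonoid u) l) _).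
  intros eps. apply is_lim_seq_spec in He. destruct (He eps) as [N HN].
  exists N. intros n Hn. unfold ball_norm.
  change (Cmod (@sum_n C_AbelianMonoid u n - l) < eps)%R.
  rewrite <- Cmod_opp.
  replace (- (@sum_n C_AbelianMonoid u n - l))
    with (l - @sum_n C_AbelianMonoid u n) by ring.
  eapply Rle_lt_trans; [apply Hu|].
  eapply Rle_lt_trans; [|apply (HN n Hn)]. rewrite Rminus_0_r. apply Rle_abs.
Qed.

Lemma has_taylor_Csum (f : C -> C) (a : nat -> C) :
  has_taylor f a <->
  forall z, in_disk z -> Csum (fun n => z ^ n * a n) (f z).
Proof.
  unfold has_taylor, is_pseries. split; intros H z Hz.
  - eapply Csum_ext; [|exact (H z Hz)]. intros n. now rewrite pow_n_Cpow.
  - eapply Csum_ext; [|exact (H z Hz)]. intros n. now rewrite pow_n_Cpow.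
Qed.

(** On the real segment the real and imaginary parts of the two expansions are
    real power series with the same sum, so real uniqueness applies to each. *)
Lemma has_taylor_unique (f : C -> C) (a b : nat -> C) :
  has_taylor f a -> has_taylor f b -> forall n, a n = b n.
Proof.
  assert (Key : forall (c d : nat -> R),
    (forall x : R, (Rabs x < 1)%R -> exists l : R,
        is_pseries c x l /\ is_pseries d x l) -> forall n, c n = d n).
  { intros c d H n.
    assert (Hrad : forall e : nat -> R, ex_series (fun n => e n * (1/2) ^ n)%R ->
               Rbar_lt 0 (CV_radius e)).
    { intros e He. apply Rbar_lt_le_trans with (Finite (1/2)).
      - simpl; lra.
      - apply Rbar_not_lt_le. intros Hlt.
        apply (CV_disk_outside e (1/2)).
        + rewrite Rabs_pos_eq by lra. exact Hlt.
        + now apply ex_series_lim_0. }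
    destruct (H (1/2)%R) as [l0 [Hc Hd]].
    { rewrite Rabs_pos_eq; lra. }
    apply PSeries_ext_recip.
    - apply Hrad. exists l0. now apply is_pseries_R.
    - apply Hrad. exists l0. now apply is_pseries_R.
    - exists (mkposreal 1 Rlt_0_1). intros x Hx.
      destruct (H x) as [l [H1 H2]].
      { unfold ball in Hx. simpl in Hx. unfold AbsRing_ball, abs, minus, plus, opp in Hx.
        simpl in Hx. now rewrite Ropp_0, Rplus_0_r in Hx. }
      now rewrite (is_pseries_unique _ _ _ H1), (is_pseries_unique _ _ _ H2). }
  intros Ha Hb n.
  rewrite has_taylor_Csum in Ha, Hb.
  assert (Hr : forall x : R, (Rabs x < 1)%R -> in_disk (RtoC x)).
  { intros x Hx. unfold in_disk. now rewrite Cmod_R. }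
  assert (Hpow : forall (x : R) k (c : C),
            RtoC x ^ k * c = (Re c * x ^ k, Im c * x ^ k)%R).
  { intros x k c. rewrite <- RtoC_pow. unfold Cmult, RtoC, Re, Im. simpl.
    f_equal; ring. }
  rewrite (surjective_pairing (a n)), (surjective_pairing (b n)). f_equal.
  - apply (Key (fun n => Re (a n)) (fun n => Re (b n))). intros x Hx.
    exists (Re (f x)). split; apply is_pseries_R.
    + destruct (proj1 (is_series_C _ _) (Ha x (Hr x Hx))) as [H _].
      eapply is_series_ext; [|exact H]. intros k. cbv beta. now rewrite Hpow.
    + destruct (proj1 (is_series_C _ _) (Hb x (Hr x Hx))) as [H _].
      eapply is_series_ext; [|exact H]. intros k. cbv beta. now rewrite Hpow.
  - apply (Key (fun n => Im (a n)) (fun n => Im (b n))). intros x Hx.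
    exists (Im (f x)). split; apply is_pseries_R.
    + destruct (proj1 (is_series_C _ _) (Ha x (Hr x Hx))) as [_ H].
      eapply is_series_ext; [|exact H]. intros k. cbv beta. now rewrite Hpow.
    + destruct (proj1 (is_series_C _ _) (Hb x (Hr x Hx))) as [_ H].
      eapply is_series_ext; [|exact H]. intros k. cbv beta. now rewrite Hpow.
Qed.

(** * Energy balance of the cascade *)

(** A bound on the l^2 norm, phrased through partial sums so that finite energy
    balances yield it without any limit. *)
Definition ell2_le (a : nat -> C) (A : R) : Prop :=
  forall N, (sum_n (fun n => Cmod (a n) ^ 2) N <= A)%R.

Lemma sum_n_S_R (u : nat -> R) (N : nat) :
  sum_n u (S N) = (sum_n u N + u (S N))%R.
Proof. exact (sum_Sn u N). Qed.

Lemma sum_n_nonneg (u : nat -> R) (N : nat) :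
  (forall n, (0 <= u n)%R) -> (0 <= sum_n u N)%R.
Proof.
  intros H. induction N as [|N IH].
  - rewrite sum_O. apply H.
  - rewrite sum_n_S_R. apply Rplus_le_le_0_compat; [exact IH|apply H].
Qed.

Lemma sum_n_mono (u : nat -> R) (N K : nat) :
  (forall n, (0 <= u n)%R) -> (N <= K)%nat -> (sum_n u N <= sum_n u K)%R.
Proof.
  intros H HNK. induction HNK as [|K _ IH]; [apply Rle_refl|].
  rewrite sum_n_S_R. specialize (H (S K)). lra.
Qed.

Lemma ell2_le_nonneg (a : nat -> C) (A : R) : ell2_le a A -> (0 <= A)%R.
Proof.
  intros H. eapply Rle_trans; [|apply (H 0%nat)].
  apply sum_n_nonneg. intros n. apply pow2_ge_0.
Qed.

Lemma ell2_le_entry (a : nat -> C) (A : R) :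
  ell2_le a A -> forall n, (Cmod (a n) <= sqrt A)%R.
Proof.
  intros H n. rewrite <- (sqrt_pow2 (Cmod (a n))) by apply Cmod_ge_0.
  apply sqrt_le_1_alt. eapply Rle_trans; [|apply (H n)].
  destruct n as [|n].
  - rewrite sum_O. apply Rle_refl.
  - rewrite sum_n_S_R.
    assert (0 <= sum_n (fun n => Cmod (a n) ^ 2) n)%R
      by (apply sum_n_nonneg; intros k; apply pow2_ge_0).
    lra.
Qed.

Lemma ell2_le_series (a : nat -> C) (A : R) :
  ell2_le a A ->
  exists L, is_series (fun n => Cmod (a n) ^ 2)%R L /\ (L <= A)%R.
Proof.
  intros H.
  destruct (ex_finite_lim_seq_incr (sum_n (fun n => Cmod (a n) ^ 2)%R) A) as [L HL].
  - intros n. apply sum_n_mono; [intros k; apply pow2_ge_0|lia].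
  - exact H.
  - exists L. split; [exact HL|].
    exact (is_lim_seq_le _ _ L A H HL (is_lim_seq_const A)).
Qed.

Lemma ell2_le_of_series (a : nat -> C) (L : R) :
  is_series (fun n => Cmod (a n) ^ 2)%R L -> ell2_le a L.
Proof.
  intros H N.
  apply (is_lim_seq_incr_compare _ L H).
  intros n. apply sum_n_mono; [intros k; apply pow2_ge_0|lia].
Qed.

Definition defect (q : C) : R := sqrt (1 - Cmod q ^ 2).

Lemma defect_sq (q : C) : (Cmod q < 1)%R -> (defect q ^ 2 = 1 - Cmod q ^ 2)%R.
Proof.
  intros Hq. apply pow2_sqrt. pose proof (Cmod_ge_0 q). nra.
Qed.

Lemma defect_bounds (q : C) : (Cmod q < 1)%R -> (0 < defect q <= 1)%R.
Proof.
  intros Hq. pose proof (defect_sq q Hq) as E. pose proof (Cmod_ge_0 q).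
  split.
  - apply sqrt_lt_R0. nra.
  - pose proof (sqrt_pos (1 - Cmod q ^ 2)) as P. fold (defect q) in P. nra.
Qed.

(** One time step, from the states [x n] at time [m], of an infinite cascade of
    cells given by the unitary 2 x 2 matrix with rows [(conj q, d)] and [(d, - q)],
    [d = defect q]. The cell with state [x n] receives the signal [g] of cell
    [n + 1], moves to the new state [conj q * x n + d * g], and emits
    [d * x n - q * g] towards cell [n - 1]. The series below is that recursion
    solved from infinity. *)
Definition output (q : C) (x : nat -> C) (n : nat) : C :=
  defect q * CSeries (fun k => (- q) ^ k * x (n + k)%nat).

Definition next_state (q : C) (x : nat -> C) (n : nat) : C :=
  Cconj q * x n + defect q * output q x (S n).

Lemma output_term_bound (q : C) (x : nat -> C) (n : nat) (M : R) :
  (forall k, (n <= k)%nat -> (Cmod (x k) <= M)%R) ->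
  forall k, (Cmod ((- q) ^ k * x (n + k)%nat) <= Cmod q ^ k * M)%R.
Proof.
  intros Hx k. rewrite Cmod_mult, Cmod_pow, Cmod_opp.
  apply Rmult_le_compat_l; [apply pow_le, Cmod_ge_0|apply Hx; lia].
Qed.

Lemma output_bound (q : C) (x : nat -> C) (n : nat) (M : R) :
  (Cmod q < 1)%R ->
  (forall k, (n <= k)%nat -> (Cmod (x k) <= M)%R) ->
  (Cmod (output q x n) <= / (1 - Cmod q) * M)%R.
Proof.
  intros Hq Hx. unfold output.
  destruct (Csum_geometric_bound (Cmod q) _ M (conj (Cmod_ge_0 q) Hq)
              (output_term_bound q x n M Hx)) as [_ HB].
  rewrite Cmod_mult, Cmod_R.
  destruct (defect_bounds q Hq) as [H0 H1].
  rewrite Rabs_pos_eq by lra.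
  eapply Rle_trans; [|exact HB].
  rewrite <- (Rmult_1_l (Cmod (CSeries _))) at 2.
  apply Rmult_le_compat_r; [apply Cmod_ge_0|exact H1].
Qed.

Lemma output_rec (q : C) (x : nat -> C) (M : R) :
  (Cmod q < 1)%R -> (forall k, (Cmod (x k) <= M)%R) ->
  forall n, output q x n = defect q * x n - q * output q x (S n).
Proof.
  intros Hq Hx n.
  assert (HS : forall m, Csum (fun k => (- q) ^ k * x (m + k)%nat)
                           (CSeries (fun k => (- q) ^ k * x (m + k)%nat))).
  { intros m. apply (Csum_geometric_bound (Cmod q) _ M (conj (Cmod_ge_0 q) Hq)).
    apply output_term_bound. intros k _. apply Hx. }
  assert (E : CSeries (fun k => (- q) ^ k * x (n + k)%nat) - x n
              = - q * CSeries (fun k => (- q) ^ k * x (S n + k)%nat)).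
  { apply (Csum_unique (fun k => (- q) ^ (S k) * x (n + S k)%nat)).
    - pose proof (Csum_incr_1 _ _ (HS n)) as H. cbv beta in H.
      rewrite Nat.add_0_r in H. simpl Cpow in H. rewrite Cmult_1_l in H. exact H.
    - eapply Csum_ext; [|exact (Csum_scal (- q) _ _ (HS (S n)))].
      intros k. cbv beta. rewrite <- plus_n_Sm. simpl. ring. }
  unfold output.
  replace (CSeries (fun k => (- q) ^ k * x (n + k)%nat))
    with (x n + - q * CSeries (fun k => (- q) ^ k * x (S n + k)%nat))
    by (rewrite <- E; ring).
  ring.
Qed.

(** Norm preservation by one cell: this is where [d^2 + |q|^2 = 1] enters. *)
Lemma colligation_unitary (q x g : C) : (Cmod q < 1)%R ->
  (Cmod (Cconj q * x + defect q * g) ^ 2 + Cmod (defect q * x - q * g) ^ 2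
   = Cmod x ^ 2 + Cmod g ^ 2)%R.
Proof.
  intros Hq. pose proof (defect_sq q Hq) as E.
  rewrite Cmod_sq in E. rewrite !Cmod_sq.
  destruct q as [q1 q2], x as [x1 x2], g as [g1 g2]. simpl in *.
  set (s := defect (q1, q2)) in *. clearbody s.
  transitivity ((q1 ^ 2 + q2 ^ 2 + s ^ 2) * (x1 ^ 2 + x2 ^ 2 + (g1 ^ 2 + g2 ^ 2)))%R.
  - ring.
  - replace (q1 ^ 2 + q2 ^ 2 + s ^ 2)%R with 1%R by (simpl; lra). ring.
Qed.

(** Adding up the balance of the single cells telescopes: the signal that
    leaves cell [n + 1] is the one that enters cell [n]. *)
Lemma energy_balance (q : C) (x : nat -> C) (M : R) :
  (Cmod q < 1)%R -> (forall k, (Cmod (x k) <= M)%R) ->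
  forall N,
  (sum_n (fun n => Cmod (next_state q x n) ^ 2) N + Cmod (output q x 0) ^ 2
   = sum_n (fun n => Cmod (x n) ^ 2) N + Cmod (output q x (S N)) ^ 2)%R.
Proof.
  intros Hq Hx.
  assert (E : forall n, (Cmod (next_state q x n) ^ 2 + Cmod (output q x n) ^ 2
                         = Cmod (x n) ^ 2 + Cmod (output q x (S n)) ^ 2)%R).
  { intros n. rewrite (output_rec q x M Hq Hx n).
    apply colligation_unitary, Hq. }
  intros N. induction N as [|N IH].
  - rewrite !sum_O. apply E.
  - rewrite !sum_n_S_R. specialize (E (S N)).
    lra.
Qed.

Lemma output_tends_to_0 (q : C) (x : nat -> C) (A : R) :
  (Cmod q < 1)%R -> ell2_le x A ->
  is_lim_seq (fun n => Cmod (output q x n)) 0%R.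
Proof.
  intros Hq Hx.
  destruct (ell2_le_series x A Hx) as [L [HL _]].
  assert (H0 : is_lim_seq (fun n => Cmod (x n) ^ 2)%R 0%R).
  { apply ex_series_lim_0. now exists L. }
  apply is_lim_seq_spec. intros eps.
  assert (Hd : (0 < 1 - Cmod q)%R) by lra.
  (* [d] compensates the geometric constant of [output_bound]; the square is
     there because the states are square summable. *)
  set (d := ((1 - Cmod q) * (eps / 2))%R).
  assert (Hdp : (0 < d)%R).
  { apply Rmult_lt_0_compat; [exact Hd|]. apply is_pos_div_2. }
  assert (Hd2 : (0 < d ^ 2)%R) by (apply pow_lt; exact Hdp).
  apply is_lim_seq_spec in H0.
  destruct (H0 (mkposreal _ Hd2)) as [N HN]. simpl in HN.
  exists N. intros n Hn.
  rewrite Rminus_0_r, Rabs_pos_eq by apply Cmod_ge_0.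
  apply Rle_lt_trans with (/ (1 - Cmod q) * d)%R.
  - apply output_bound; [exact Hq|]. intros k Hk.
    specialize (HN k ltac:(lia)).
    rewrite Rminus_0_r in HN. apply Rabs_def2 in HN.
    pose proof (Cmod_ge_0 (x k)). nra.
  - unfold d. destruct eps as [e He]. simpl.
    replace (/ (1 - Cmod q) * ((1 - Cmod q) * (e / 2)))%R with (e / 2)%R
      by (field; lra).
    lra.
Qed.

(** The signal entering from infinity dies out, so what cell 0 emits is taken
    from the energy of the states. *)
Lemma next_state_energy (q : C) (x : nat -> C) (A : R) :
  (Cmod q < 1)%R -> ell2_le x A ->
  ell2_le (next_state q x) (A - Cmod (output q x 0) ^ 2).
Proof.
  intros Hq Hx N.
  set (u := fun n => (Cmod (next_state q x n) ^ 2)%R).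
  assert (H : (sum_n u N + Cmod (output q x 0) ^ 2 <= A + 0)%R); [|lra].
  assert (Hlim : is_lim_seq (fun K => A + Cmod (output q x (S K)) ^ 2)%R (A + 0)%R).
  { apply is_lim_seq_plus'; [apply is_lim_seq_const|].
    replace 0%R with (0 * (0 * 1))%R by ring.
    pose proof (proj1 (is_lim_seq_incr_1 _ _) (output_tends_to_0 q x A Hq Hx)) as HT.
    apply is_lim_seq_mult'; [exact HT|].
    apply is_lim_seq_mult'; [exact HT|apply is_lim_seq_const]. }
  refine (is_lim_seq_le_loc _ _ _ (Finite (A + 0)%R) _ (is_lim_seq_const _) Hlim).
  exists N. intros K HK.
  pose proof (energy_balance q x (sqrt A) Hq (ell2_le_entry x A Hx) K) as E.
  pose proof (sum_n_mono u N K (fun n => pow2_ge_0 _) HK) as HM.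
  specialize (Hx K). unfold u in *. lra.
Qed.

Definition state (q : C) (x : nat -> C) (m : nat) : nat -> C :=
  Nat.iter m (next_state q) x.

Lemma state_energy (q : C) (x : nat -> C) (A : R) :
  (Cmod q < 1)%R -> ell2_le x A ->
  forall m, ell2_le (state q x (S m))
              (A - sum_n (fun k => (Cmod (output q (state q x k) 0) ^ 2)%R) m).
Proof.
  intros Hq Hx m. induction m as [|m IH].
  - rewrite sum_O. now apply next_state_energy.
  - rewrite sum_n_S_R.
    pose proof (next_state_energy q _ _ Hq IH) as H.
    intros N. refine (Rle_trans _ _ _ (H N) _). lra.
Qed.

Lemma state_le (q : C) (x : nat -> C) (A : R) :
  (Cmod q < 1)%R -> ell2_le x A -> forall m, ell2_le (state q x m) A.
Proof.
  intros Hq Hx [|m]; [exact Hx|]. intros N.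
  eapply Rle_trans; [apply (state_energy q x A Hq Hx m N)|].
  assert (0 <= sum_n (fun k => (Cmod (output q (state q x k) 0) ^ 2)%R) m)%R
    by (apply sum_n_nonneg; intros k; apply pow2_ge_0).
  lra.
Qed.

Lemma output_energy (q : C) (x : nat -> C) (A : R) :
  (Cmod q < 1)%R -> ell2_le x A ->
  ell2_le (fun m => output q (state q x m) 0) A.
Proof.
  intros Hq Hx m.
  pose proof (ell2_le_nonneg _ _ (state_energy q x A Hq Hx m)). lra.
Qed.

(** * Weighted compositions as transfer functions *)

Lemma one_minus_neq_0 (a z : C) :
  (Cmod a < 1)%R -> in_disk z -> 1 - a * z <> 0.
Proof.
  intros Ha Hz E. unfold in_disk in Hz.
  assert (E1 : a * z = 1) by (rewrite <- (Cplus_0_r (a * z)), <- E; ring).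
  apply (f_equal Cmod) in E1. rewrite Cmod_mult, Cmod_1 in E1.
  pose proof (Cmod_ge_0 a). pose proof (Cmod_ge_0 z). nra.
Qed.

Lemma blaschke_lt_1 (q z : C) :
  (Cmod q < 1)%R -> in_disk z -> (Cmod ((z - q) / (1 - Cconj q * z)) < 1)%R.
Proof.
  intros Hq Hz.
  assert (Hd : 1 - Cconj q * z <> 0)
    by (apply one_minus_neq_0; [now rewrite Cmod_conj|exact Hz]).
  rewrite Cmod_div by exact Hd. apply Cmod_gt_0 in Hd.
  apply Rlt_div_l; [exact Hd|]. rewrite Rmult_1_l.
  apply Rsqr_incrst_0; [|apply Cmod_ge_0|apply Cmod_ge_0].
  rewrite !Rsqr_pow2. unfold in_disk in Hz.
  pose proof (Cmod_ge_0 q) as Hq0. pose proof (Cmod_ge_0 z) as Hz0.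
  assert (Pq : (0 < 1 - Cmod q ^ 2)%R) by nra.
  assert (Pz : (0 < 1 - Cmod z ^ 2)%R) by nra.
  pose proof (Rmult_lt_0_compat _ _ Pq Pz) as P.
  rewrite !Cmod_sq in *. destruct q as [q1 q2], z as [z1 z2]. simpl in *. nra.
Qed.

(** Generating functions in the time variable [m] turn the cell recursion into
    algebra: [X = x n + z (conj q X + d Y')] and [Y = d X - q Y'], where [Y] and
    [Y'] belong to the signals emitted by cells [n] and [n + 1]. Eliminating [X]
    leaves the identity below, in which the Blaschke factor
    [(z - q) / (1 - conj q z)] multiplies [Y']. The bound on [Y], uniform in
    [n], makes the iteration of this identity converge. *)
Lemma transfer_step (q : C) (x : nat -> C) (A : R) (z : C) :
  (Cmod q < 1)%R -> ell2_le x A -> in_disk z ->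
  let X n := CSeries (fun m => z ^ m * state q x m n) in
  let Y n := CSeries (fun m => z ^ m * output q (state q x m) n) in
  let B := (/ (1 - Cmod q) * sqrt A)%R in
  forall n,
  Csum (fun m => z ^ m * output q (state q x m) n) (Y n) /\
  (Cmod (Y n) <= / (1 - Cmod z) * B)%R /\
  (1 - Cconj q * z) * Y n = defect q * x n + (z - q) * Y (S n).
Proof.
  intros Hq Hx Hz X Y B.
  assert (Hs : forall m n, (Cmod (state q x m n) <= sqrt A)%R).
  { intros m. apply ell2_le_entry, state_le; assumption. }
  assert (Hz' : (0 <= Cmod z < 1)%R) by (split; [apply Cmod_ge_0|exact Hz]).
  assert (HX : forall n, Csum (fun m => z ^ m * state q x m n) (X n)).
  { intros n. apply (Csum_geometric_bound (Cmod z) _ (sqrt A) Hz').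
    intros m. rewrite Cmod_mult, Cmod_pow.
    apply Rmult_le_compat_l; [apply pow_le, Cmod_ge_0|apply Hs]. }
  assert (HY : forall n, Csum (fun m => z ^ m * output q (state q x m) n) (Y n) /\
                         (Cmod (Y n) <= / (1 - Cmod z) * B)%R).
  { intros n. apply (Csum_geometric_bound (Cmod z) _ B Hz').
    intros m. rewrite Cmod_mult, Cmod_pow.
    apply Rmult_le_compat_l; [apply pow_le, Cmod_ge_0|].
    apply output_bound; [exact Hq|]. intros k _. apply Hs. }
  intros n. destruct (HY n) as [HYn HBn]. split; [exact HYn|]. split; [exact HBn|].
  assert (EX : X n - x n = z * (Cconj q * X n + defect q * Y (S n))).
  { apply (Csum_unique (fun m => z ^ S m * state q x (S m) n)).
    - pose proof (Csum_incr_1 _ _ (HX n)) as H. simpl in H.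
      rewrite Cmult_1_l in H. exact H.
    - eapply Csum_ext; [|exact (Csum_scal z _ _ (Csum_plus _ _ _ _
        (Csum_scal (Cconj q) _ _ (HX n))
        (Csum_scal (defect q) _ _ (proj1 (HY (S n))))))].
      intros m. simpl. unfold next_state. ring. }
  assert (EY : Y n = defect q * X n - q * Y (S n)).
  { apply (Csum_unique _ _ _ HYn).
    replace (defect q * X n - q * Y (S n))
      with (defect q * X n + (- q) * Y (S n)) by ring.
    eapply Csum_ext; [|exact (Csum_plus _ _ _ _
        (Csum_scal (defect q) _ _ (HX n))
        (Csum_scal (- q) _ _ (proj1 (HY (S n)))))].
    intros m. simpl.
    rewrite (output_rec q _ (sqrt A) Hq (Hs m) n). ring. }
  assert (Ed : RtoC (defect q) * RtoC (defect q) = 1 - q * Cconj q).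
  { rewrite <- Cmod2_conj, <- RtoC_mult, <- RtoC_minus. f_equal.
    rewrite <- (defect_sq q Hq). ring. }
  transitivity (defect q * (X n - Cconj q * z * X n)
                - q * (1 - Cconj q * z) * Y (S n)); [rewrite EY; ring|].
  replace (X n - Cconj q * z * X n) with (x n + z * (defect q * Y (S n)))
    by (transitivity (x n + (X n - x n) - Cconj q * z * X n);
        [rewrite EX; ring|ring]).
  transitivity (defect q * x n + z * (RtoC (defect q) * RtoC (defect q)) * Y (S n)
     - q * (1 - Cconj q * z) * Y (S n)); [ring|].
  rewrite Ed. ring.
Qed.

(** Iterating the transfer identity over all cells: the generating function of
    the emitted signals is the weight [d / (1 - conj q z)] times the power
    series with coefficients [x] evaluated at the Blaschke factor. *)
Lemma output_transfer (q : C) (x : nat -> C) (A : R) (z l : C) :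
  (Cmod q < 1)%R -> ell2_le x A -> in_disk z ->
  Csum (fun n => ((z - q) / (1 - Cconj q * z)) ^ n * x n) l ->
  Csum (fun m => z ^ m * output q (state q x m) 0)
       (defect q / (1 - Cconj q * z) * l).
Proof.
  intros Hq Hx Hz Hl.
  pose proof (transfer_step q x A z Hq Hx Hz) as T. cbv zeta in T.
  set (Y := fun n => CSeries (fun m => z ^ m * output q (state q x m) n)).
  assert (Hd : 1 - Cconj q * z <> 0)
    by (apply one_minus_neq_0; [now rewrite Cmod_conj|exact Hz]).
  pose proof (blaschke_lt_1 q z Hq Hz) as Hb.
  set (b := (z - q) / (1 - Cconj q * z)) in *.
  set (C0 := (/ (1 - Cmod z) * (/ (1 - Cmod q) * sqrt A))%R) in T.
  assert (EY : forall n, Y n = defect q / (1 - Cconj q * z) * x n + b * Y (S n)).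
  { intros n. destruct (T n) as [_ [_ E]].
    change ((1 - Cconj q * z) * Y n = defect q * x n + (z - q) * Y (S n)) in E.
    transitivity ((1 - Cconj q * z) * Y n / (1 - Cconj q * z)).
    - field. exact Hd.
    - rewrite E. unfold b. field. exact Hd. }
  (* The cascade cut after cell [N], with the signal of cell [N + 1] as the
     remainder. *)
  assert (EN : forall N, Y 0%nat =
     @sum_n C_AbelianMonoid (fun n => defect q / (1 - Cconj q * z) * (b ^ n * x n)) N
     + b ^ S N * Y (S N)).
  { intros N. induction N as [|N IH].
    - rewrite sum_O, (EY 0%nat). simpl. ring.
    - rewrite sum_Sn.
      change (Y 0%nat =
        @sum_n C_AbelianMonoid (fun n => defect q / (1 - Cconj q * z) * (b ^ n * x n)) N
        + defect q / (1 - Cconj q * z) * (b ^ S N * x (S N)) + b ^ S (S N) * Y (S (S N))).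
      rewrite IH at 1. rewrite (EY (S N)). simpl. ring. }
  assert (HS : Csum (fun n => defect q / (1 - Cconj q * z) * (b ^ n * x n)) (Y 0%nat)).
  { apply Csum_of_remainder with (e := fun n => (Cmod b ^ S n * C0)%R).
    - intros n. rewrite (EN n) at 1.
      replace (_ - _) with (b ^ S n * Y (S n)) by ring.
      rewrite Cmod_mult, Cmod_pow.
      apply Rmult_le_compat_l; [apply pow_le, Cmod_ge_0|].
      exact (proj1 (proj2 (T (S n)))).
    - replace (Finite 0) with (Rbar_mult (Finite 0) (Finite C0))
        by (simpl; f_equal; ring).
      apply is_lim_seq_scal_r.
      apply -> (is_lim_seq_incr_1 (fun n => (Cmod b ^ n)%R)).
      apply is_lim_seq_geom. rewrite Rabs_pos_eq; [exact Hb|apply Cmod_ge_0]. }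
  rewrite <- (Csum_unique _ _ _ HS (Csum_scal _ _ _ Hl)).
  exact (proj1 (T 0%nat)).
Qed.

Definition mobius (q mu : C) : C -> C :=
  fun z => mu * ((q - z) / (1 - Cconj q * z)).

Definition kern (q c : C) : C -> C :=
  fun z => c * (defect q / (1 - Cconj q * z)).

Lemma mobius_in_disk (q mu z : C) :
  (Cmod q < 1)%R -> Cmod mu = 1%R -> in_disk z -> in_disk (mobius q mu z).
Proof.
  intros Hq Hmu Hz. unfold in_disk, mobius.
  rewrite Cmod_mult, Hmu, Rmult_1_l, <- Cmod_opp.
  replace (- ((q - z) / (1 - Cconj q * z))) with ((z - q) / (1 - Cconj q * z))
    by (unfold Cdiv; ring).
  now apply blaschke_lt_1.
Qed.

(** The Taylor coefficients of the weighted composition are the signals emitted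
    by the cascade started at the coefficients of [f], twisted by the
    unimodular constants; they therefore have no more energy. *)
Lemma wcomp_contractive (q mu c : C) (f : C -> C) (a : nat -> C) (A : R) :
  (Cmod q < 1)%R -> Cmod mu = 1%R -> Cmod c = 1%R ->
  has_taylor f a -> ell2_le a A ->
  exists b, has_taylor (wcomp (kern q c) (mobius q mu) f) b /\ ell2_le b A.
Proof.
  intros Hq Hmu Hc Hf Ha.
  (* [mobius q mu] is [- mu] times the Blaschke factor of the cascade. *)
  set (x := fun n => c * ((- mu) ^ n * a n)).
  assert (Hx : ell2_le x A).
  { intros N. eapply Rle_trans; [|apply (Ha N)]. right.
    apply sum_n_ext. intros n. unfold x.
    now rewrite !Cmod_mult, Cmod_pow, Cmod_opp, Hc, Hmu, pow1, !Rmult_1_l. }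
  exists (fun m => output q (state q x m) 0). split; [|now apply output_energy].
  apply has_taylor_Csum. intros z Hz. unfold wcomp.
  pose proof (proj1 (has_taylor_Csum f a) Hf _ (mobius_in_disk q mu z Hq Hmu Hz)) as H.
  replace (kern q c z * f (mobius q mu z))
    with (defect q / (1 - Cconj q * z) * (c * f (mobius q mu z)))
    by (unfold kern; ring).
  apply (output_transfer q x A z _ Hq Hx Hz).
  eapply Csum_ext; [|exact (Csum_scal c _ _ H)].
  intros n. cbv beta. unfold x, mobius.
  replace (mu * ((q - z) / (1 - Cconj q * z)))
    with ((z - q) / (1 - Cconj q * z) * (- mu)) by (unfold Cdiv; ring).
  rewrite Cpow_mult_l. ring.
Qed.

(** * The Hilbert space structure of H^2 *)

Lemma taylor_eq (f : C -> C) (a : nat -> C) : has_taylor f a -> taylor f = a.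
Proof.
  intros H. apply functional_extensionality. intros n.
  apply (has_taylor_unique f); [|exact H].
  unfold taylor. apply epsilon_spec. now exists a.
Qed.

Lemma has_taylor_ext (f g : C -> C) (a : nat -> C) :
  eqD f g -> has_taylor f a -> has_taylor g a.
Proof.
  intros E H z Hz. rewrite <- (E z Hz). now apply H.
Qed.

Lemma H2_taylor (f : C -> C) :
  H2 f -> has_taylor f (taylor f) /\ square_summable (taylor f).
Proof. intros [a [Ha Hf]]. now rewrite (taylor_eq f a Hf). Qed.

Lemma taylor_ext (f g : C -> C) : H2 f -> eqD f g -> taylor g = taylor f.
Proof.
  intros Hf E. apply taylor_eq. eapply has_taylor_ext; [exact E|].
  now apply H2_taylor.
Qed.

Definition lincomb (a b : C) (f g : C -> C) : C -> C :=
  fun z => a * f z + b * g z.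

Lemma has_taylor_lincomb (a b : C) (f g : C -> C) (u v : nat -> C) :
  has_taylor f u -> has_taylor g v ->
  has_taylor (lincomb a b f g) (fun n => a * u n + b * v n).
Proof.
  rewrite !has_taylor_Csum. intros Hf Hg z Hz.
  eapply Csum_ext; [|exact (Csum_plus _ _ _ _ (Csum_scal a _ _ (Hf z Hz))
                              (Csum_scal b _ _ (Hg z Hz)))].
  intros n. cbv beta. ring.
Qed.

Lemma square_summable_lincomb (a b : C) (u v : nat -> C) :
  square_summable u -> square_summable v ->
  square_summable (fun n => a * u n + b * v n).
Proof.
  intros Hu Hv. unfold square_summable in *.
  apply (@ex_series_le R_AbsRing R_CompleteNormedModule)
    with (b := fun n => (2 * Cmod a ^ 2 * Cmod (u n) ^ 2
                         + 2 * Cmod b ^ 2 * Cmod (v n) ^ 2)%R).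
  - intros n. change (Rabs (Cmod (a * u n + b * v n) ^ 2) <=
      2 * Cmod a ^ 2 * Cmod (u n) ^ 2 + 2 * Cmod b ^ 2 * Cmod (v n) ^ 2)%R.
    rewrite Rabs_pos_eq by apply pow2_ge_0.
    pose proof (Cmod_triangle (a * u n) (b * v n)) as T.
    rewrite !Cmod_mult in T.
    pose proof (Cmod_ge_0 (a * u n + b * v n)).
    pose proof (pow2_ge_0 (Cmod a * Cmod (u n) - Cmod b * Cmod (v n))).
    nra.
  - apply (@ex_series_plus R_AbsRing R_NormedModule);
      now apply (@ex_series_scal R_AbsRing R_NormedModule).
Qed.

Lemma H2_lincomb (a b : C) (f g : C -> C) : H2 f -> H2 g -> H2 (lincomb a b f g).
Proof.
  intros [u [Hu Hf]] [v [Hv Hg]]. exists (fun n => a * u n + b * v n).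
  split; [now apply square_summable_lincomb|now apply has_taylor_lincomb].
Qed.

Definition norm_sq (f : C -> C) : R := Series (fun n => Cmod (taylor f n) ^ 2)%R.

Lemma norm2_norm_sq (f : C -> C) : norm2 f = sqrt (norm_sq f).
Proof.
  unfold norm2, norm_sq. f_equal. apply Series_ext. intros n.
  rewrite Cmod_sq. destruct (taylor f n) as [a b]. simpl. ring.
Qed.

Lemma polarization_Re (f g : C -> C) (c : C) : H2 f -> H2 g ->
  Series (fun n => Re (taylor f n * Cconj (c * taylor g n)))
  = ((norm_sq (lincomb 1 c f g) - norm_sq (lincomb 1 (- c) f g)) / 4)%R.
Proof.
  intros Hf Hg.
  destruct (H2_taylor f Hf) as [Tf Sf], (H2_taylor g Hg) as [Tg Sg].
  unfold norm_sq.
  rewrite !(taylor_eq _ _ (has_taylor_lincomb _ _ _ _ _ _ Tf Tg)).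
  rewrite <- Series_minus; try now apply square_summable_lincomb.
  unfold Rdiv. rewrite <- Series_scal_r. apply Series_ext. intros n.
  rewrite !Cmod_sq.
  destruct (taylor f n) as [a1 a2], (taylor g n) as [b1 b2], c as [c1 c2].
  simpl. field.
Qed.

(** With [conj (Ci * w) = - Ci * conj w], the imaginary part of the inner
    product is the real part of the inner product with [Ci * g]. *)
Lemma inner_polarization (f g : C -> C) : H2 f -> H2 g ->
  inner f g = (((norm_sq (lincomb 1 1 f g) - norm_sq (lincomb 1 (- (1)) f g)) / 4)%R,
               ((norm_sq (lincomb 1 Ci f g) - norm_sq (lincomb 1 (- Ci) f g)) / 4)%R).
Proof.
  intros Hf Hg. rewrite <- !polarization_Re by assumption.
  unfold inner, CSeries. f_equal; apply Series_ext; intros n.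
  - now rewrite Cmult_1_l.
  - destruct (taylor f n) as [a1 a2], (taylor g n) as [b1 b2]. simpl. ring.
Qed.

(** Polarization writes both inner products through norms of combinations of
    [f] and [g], and linearity moves [T] outside of these combinations. *)
Lemma inner_isometry (T : operator) :
  maps_H2 T -> linear_on_H2 T -> (forall f, H2 f -> norm_sq (T f) = norm_sq f) ->
  forall f g, H2 f -> H2 g -> inner (T f) (T g) = inner f g.
Proof.
  intros HT HL Hn f g Hf Hg.
  assert (E : forall c, norm_sq (lincomb 1 c (T f) (T g)) = norm_sq (lincomb 1 c f g)).
  { intros c. rewrite <- (Hn (lincomb 1 c f g)) by now apply H2_lincomb.
    unfold norm_sq. erewrite taylor_ext; [reflexivity| |].
    - apply HT. now apply H2_lincomb.
    - exact (HL 1 c f g Hf Hg). }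
  rewrite !inner_polarization by auto. now rewrite !E.
Qed.

(** * The unitary weighted composition operators *)

Lemma conj_unimodular (m : C) : Cmod m = 1%R -> m * Cconj m = 1.
Proof. intros H. rewrite <- Cmod2_conj, H. f_equal. ring. Qed.

(** The one computation with Moebius maps. When the zero of the map applied
    second is [m2 * b], the maps cancel up to a rotation, because
    [1 - conj (m2 b) w = d^2 / (1 - conj b z)] and
    [m2 b - w = m2 z d^2 / (1 - conj b z)] for [w = mobius b m2 z]. The inverse
    operator, the involution property and the symmetry are all instances. *)
Lemma kern_mobius_comp (b m1 m2 c1 c2 : C) (f : C -> C) (z : C) :
  (Cmod b < 1)%R -> Cmod m2 = 1%R -> in_disk z ->
  wcomp (kern b c1) (mobius b m2)
    (wcomp (kern (m2 * b) c2) (mobius (m2 * b) m1) f) z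
  = c1 * c2 * f (m1 * m2 * z).
Proof.
  intros Hb Hm Hz. unfold wcomp.
  assert (HD : 1 - Cconj b * z <> 0)
    by (apply one_minus_neq_0; [now rewrite Cmod_conj|exact Hz]).
  assert (Hd : RtoC (defect b) <> 0).
  { intros E. apply RtoC_inj in E. pose proof (defect_bounds b Hb). lra. }
  assert (Ed : RtoC (defect b) * RtoC (defect b) = 1 - b * Cconj b).
  { rewrite <- Cmod2_conj, <- RtoC_mult, <- RtoC_minus. f_equal.
    rewrite <- (defect_sq b Hb). ring. }
  assert (Edef : defect (m2 * b) = defect b).
  { unfold defect. now rewrite Cmod_mult, Hm, Rmult_1_l. }
  assert (E1 : 1 - Cconj (m2 * b) * mobius b m2 z
               = defect b * defect b / (1 - Cconj b * z)).
  { unfold mobius. rewrite Cmult_conj, Ed.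
    transitivity (1 - (m2 * Cconj m2) * Cconj b * (b - z) / (1 - Cconj b * z)).
    - field. exact HD.
    - rewrite (conj_unimodular m2 Hm). field. exact HD. }
  assert (E2 : m2 * b - mobius b m2 z
               = m2 * z * (defect b * defect b / (1 - Cconj b * z))).
  { unfold mobius. rewrite Ed. field. exact HD. }
  assert (E3 : mobius (m2 * b) m1 (mobius b m2 z) = m1 * m2 * z).
  { unfold mobius at 1. rewrite E1, E2. field. now repeat split. }
  rewrite E3. unfold kern. rewrite E1, Edef. field. now repeat split.
Qed.

Lemma wcomp_linear (psi phi : C -> C) : linear_on_H2 (wcomp psi phi).
Proof. intros a b f g _ _ z _. unfold wcomp. ring. Qed.

Lemma norm_sq_le (f : C -> C) (b : nat -> C) (A : R) :
  has_taylor f b -> ell2_le b A -> H2 f /\ (norm_sq f <= A)%R.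
Proof.
  intros Hf Hb. destruct (ell2_le_series b A Hb) as [L [HL HLA]].
  split.
  - exists b. split; [now exists L|exact Hf].
  - unfold norm_sq. rewrite (taylor_eq f b Hf), (is_series_unique _ _ HL). exact HLA.
Qed.

Lemma ell2_le_norm_sq (f : C -> C) : H2 f -> ell2_le (taylor f) (norm_sq f).
Proof.
  intros Hf. apply ell2_le_of_series, Series_correct. now apply H2_taylor.
Qed.

Lemma wcomp_H2_contraction (q mu c : C) (f : C -> C) :
  (Cmod q < 1)%R -> Cmod mu = 1%R -> Cmod c = 1%R -> H2 f ->
  H2 (wcomp (kern q c) (mobius q mu) f) /\
  (norm_sq (wcomp (kern q c) (mobius q mu) f) <= norm_sq f)%R.
Proof.
  intros Hq Hmu Hc Hf.
  destruct (wcomp_contractive q mu c f _ _ Hq Hmu Hc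
              (proj1 (H2_taylor f Hf)) (ell2_le_norm_sq f Hf)) as [b [Tb Lb]].
  exact (norm_sq_le _ b _ Tb Lb).
Qed.

Lemma wcomp_inverse (q mu c : C) (f : C -> C) :
  (Cmod q < 1)%R -> Cmod mu = 1%R -> Cmod c = 1%R ->
  eqD (wcomp (kern q c) (mobius q mu)
         (wcomp (kern (mu * q) (Cconj c)) (mobius (mu * q) (Cconj mu)) f)) f.
Proof.
  intros Hq Hmu Hc z Hz. rewrite kern_mobius_comp by assumption.
  rewrite (conj_unimodular c Hc), (Cmult_comm (Cconj mu)), (conj_unimodular mu Hmu).
  now rewrite !Cmult_1_l.
Qed.

Lemma wcomp_inverse_l (q mu c : C) (f : C -> C) :
  (Cmod q < 1)%R -> Cmod mu = 1%R -> Cmod c = 1%R ->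
  eqD (wcomp (kern (mu * q) (Cconj c)) (mobius (mu * q) (Cconj mu))
         (wcomp (kern q c) (mobius q mu) f)) f.
Proof.
  intros Hq Hmu Hc.
  pose proof (wcomp_inverse (mu * q) (Cconj mu) (Cconj c) f) as H.
  rewrite !Cconj_conj, !Cmod_conj, Cmod_mult, Hmu, Rmult_1_l in H.
  rewrite Cmult_assoc, (Cmult_comm (Cconj mu)), (conj_unimodular mu Hmu),
    Cmult_1_l in H.
  now apply H.
Qed.

(** The inverse belongs to the same family, hence is a contraction too; a
    contraction with contractive inverse preserves norms. *)
Lemma wcomp_isometry (q mu c : C) (f : C -> C) :
  (Cmod q < 1)%R -> Cmod mu = 1%R -> Cmod c = 1%R -> H2 f ->
  norm_sq (wcomp (kern q c) (mobius q mu) f) = norm_sq f.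
Proof.
  intros Hq Hmu Hc Hf.
  destruct (wcomp_H2_contraction q mu c f Hq Hmu Hc Hf) as [H1 H2].
  apply Rle_antisym; [exact H2|].
  destruct (wcomp_H2_contraction (mu * q) (Cconj mu) (Cconj c) _
     ltac:(now rewrite Cmod_mult, Hmu, Rmult_1_l)
     ltac:(now rewrite Cmod_conj) ltac:(now rewrite Cmod_conj) H1) as [H3 H4].
  eapply Rle_trans; [|exact H4]. right. unfold norm_sq.
  now rewrite <- (taylor_ext _ f H3 (wcomp_inverse_l q mu c f Hq Hmu Hc)).
Qed.

Lemma wcomp_bounded (q mu c : C) :
  (Cmod q < 1)%R -> Cmod mu = 1%R -> Cmod c = 1%R ->
  bounded_operator (wcomp (kern q c) (mobius q mu)).
Proof.
  intros Hq Hmu Hc. split; [|split].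
  - intros f Hf. now apply wcomp_H2_contraction.
  - apply wcomp_linear.
  - exists 1%R. intros f Hf. rewrite !norm2_norm_sq, wcomp_isometry by assumption.
    rewrite Rmult_1_l. apply Rle_refl.
Qed.

(** A surjective isometry has its inverse as adjoint:
    [<T f, g> = <T f, T (S g)> = <f, S g>]. *)
Lemma wcomp_adjoint (q mu c : C) :
  (Cmod q < 1)%R -> Cmod mu = 1%R -> Cmod c = 1%R ->
  is_adjoint (wcomp (kern q c) (mobius q mu))
    (wcomp (kern (mu * q) (Cconj c)) (mobius (mu * q) (Cconj mu))).
Proof.
  intros Hq Hmu Hc.
  assert (HB : bounded_operator
    (wcomp (kern (mu * q) (Cconj c)) (mobius (mu * q) (Cconj mu)))).
  { apply wcomp_bounded; rewrite ?Cmod_conj; try assumption.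
    now rewrite Cmod_mult, Hmu, Rmult_1_l. }
  split; [exact HB|]. intros f g Hf Hg.
  destruct (wcomp_bounded q mu c Hq Hmu Hc) as [HM [HL _]].
  rewrite <- (inner_isometry _ HM HL (fun f => wcomp_isometry q mu c f Hq Hmu Hc)
                f _ Hf (proj1 HB g Hg)).
  unfold inner.
  now rewrite (taylor_ext _ g (HM _ (proj1 HB g Hg)) (wcomp_inverse q mu c g Hq Hmu Hc)).
Qed.

Lemma wcomp_unitary (q mu c : C) :
  (Cmod q < 1)%R -> Cmod mu = 1%R -> Cmod c = 1%R ->
  unitary_operator (wcomp (kern q c) (mobius q mu)).
Proof.
  intros Hq Hmu Hc. split; [now apply wcomp_bounded|].
  eexists. split; [now apply wcomp_adjoint|].
  intros f _. split; [now apply wcomp_inverse_l|now apply wcomp_inverse].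
Qed.

(** * The action of [J] on the family of operators *)

(** The action of [J], free of Taylor coefficients; see [J_sharp]. *)
Definition sharp (f : C -> C) : C -> C := fun z => Cconj (f (Cconj z)).

Lemma in_disk_conj (z : C) : in_disk z -> in_disk (Cconj z).
Proof. unfold in_disk. now rewrite Cmod_conj. Qed.

Lemma has_taylor_sharp (f : C -> C) (a : nat -> C) :
  has_taylor f a -> has_taylor (sharp f) (fun n => Cconj (a n)).
Proof.
  rewrite !has_taylor_Csum. intros H z Hz.
  eapply Csum_ext; [|exact (Csum_conj _ _ (H _ (in_disk_conj z Hz)))].
  intros n. cbv beta. now rewrite Cmult_conj, <- Cpow_conj, Cconj_conj.
Qed.

Lemma J_sharp (f : C -> C) : H2 f -> eqD (J f) (sharp f).
Proof.
  intros Hf z Hz. unfold J. apply CSeries_unique.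
  pose proof (has_taylor_sharp f _ (proj1 (H2_taylor f Hf))) as H.
  rewrite has_taylor_Csum in H.
  eapply Csum_ext; [|exact (H z Hz)]. intros n. apply Cmult_comm.
Qed.

Lemma has_taylor_J (f : C -> C) : H2 f ->
  has_taylor (J f) (fun n => Cconj (taylor f n)).
Proof.
  intros Hf. apply has_taylor_ext with (sharp f).
  - intros z Hz. symmetry. now apply J_sharp.
  - apply has_taylor_sharp. now apply H2_taylor.
Qed.

Lemma J_H2_isometry (f : C -> C) : H2 f -> H2 (J f) /\ norm_sq (J f) = norm_sq f.
Proof.
  intros Hf. pose proof (has_taylor_J f Hf) as HT. split.
  - exists (fun n => Cconj (taylor f n)). split; [|exact HT].
    eapply ex_series_ext; [|exact (proj2 (H2_taylor f Hf))].
    intros n. cbv beta. now rewrite Cmod_conj.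
  - unfold norm_sq. rewrite (taylor_eq _ _ HT). apply Series_ext.
    intros n. now rewrite Cmod_conj.
Qed.

Lemma kern_conj (q c z : C) : (Cmod q < 1)%R -> in_disk z ->
  Cconj (kern q c (Cconj z)) = kern (Cconj q) (Cconj c) z.
Proof.
  intros Hq Hz. unfold kern, defect.
  rewrite Cmult_conj, Cdiv_conj, Cminus_conj, Cmult_conj, !Cconj_conj, Cmod_conj.
  - f_equal. f_equal; [|f_equal; f_equal];
    unfold Cconj, RtoC; simpl; now rewrite Ropp_0.
  - apply one_minus_neq_0; [now rewrite Cmod_conj|now apply in_disk_conj].
Qed.

Lemma mobius_conj (q mu z : C) : (Cmod q < 1)%R -> in_disk z ->
  Cconj (mobius q mu (Cconj z)) = mobius (Cconj q) (Cconj mu) z.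
Proof.
  intros Hq Hz. unfold mobius.
  rewrite Cmult_conj, Cdiv_conj, !Cminus_conj, Cmult_conj, !Cconj_conj.
  - f_equal. f_equal. f_equal. f_equal. unfold Cconj, RtoC; simpl; now rewrite Ropp_0.
  - apply one_minus_neq_0; [now rewrite Cmod_conj|now apply in_disk_conj].
Qed.

Lemma sharp_wcomp (q mu c : C) (f : C -> C) : (Cmod q < 1)%R ->
  eqD (sharp (wcomp (kern q c) (mobius q mu) f))
    (wcomp (kern (Cconj q) (Cconj c)) (mobius (Cconj q) (Cconj mu)) (sharp f)).
Proof.
  intros Hq z Hz. unfold sharp, wcomp.
  rewrite Cmult_conj, kern_conj by assumption. f_equal. f_equal. f_equal.
  rewrite <- mobius_conj by assumption. now rewrite Cconj_conj.
Qed.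

Lemma wcomp_eqD (q mu c : C) (f g : C -> C) :
  (Cmod q < 1)%R -> Cmod mu = 1%R -> eqD f g ->
  eqD (wcomp (kern q c) (mobius q mu) f) (wcomp (kern q c) (mobius q mu) g).
Proof.
  intros Hq Hmu E z Hz. unfold wcomp. f_equal. apply E.
  now apply mobius_in_disk.
Qed.

Lemma Cconj_1 : Cconj 1 = 1.
Proof. unfold Cconj, RtoC. simpl. now rewrite Ropp_0. Qed.

Lemma J_wcomp (q mu c : C) (f : C -> C) :
  (Cmod q < 1)%R -> Cmod mu = 1%R -> Cmod c = 1%R -> H2 f ->
  eqD (J (wcomp (kern q c) (mobius q mu) f))
    (wcomp (kern (Cconj q) (Cconj c)) (mobius (Cconj q) (Cconj mu)) (sharp f)).
Proof.
  intros Hq Hmu Hc Hf z Hz.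
  rewrite J_sharp; [|now apply wcomp_H2_contraction|exact Hz].
  now apply sharp_wcomp.
Qed.

(** The hypothesis [lambda * p = conj p] says that conjugating the parameters
    of [W] by [J] produces those of the inverse of [W], that is
    [J W J = W^-1], and so [(J W)^2 = 1]. *)
Lemma J_wcomp_conjugation (p lambda : C) :
  (Cmod p < 1)%R -> Cmod lambda = 1%R -> lambda * p = Cconj p ->
  conjugation (fun f => J (wcomp (kern p 1) (mobius p lambda) f)).
Proof.
  intros Hp Hl Elp.
  assert (HH : forall f, H2 f -> H2 (wcomp (kern p 1) (mobius p lambda) f))
    by (intros f Hf; apply wcomp_H2_contraction; auto using Cmod_1).
  assert (HJ : forall f, H2 f -> H2 (J (wcomp (kern p 1) (mobius p lambda) f)))
    by (intros f Hf; apply J_H2_isometry; auto).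
  split; [exact HJ|split; [|split]].
  - intros a b f g Hf Hg z Hz.
    rewrite !J_sharp; auto; [|now apply HH, (H2_lincomb a b f g)].
    unfold sharp, wcomp. rewrite !Cmult_conj, Cplus_conj, !Cmult_conj. ring.
  - intros f Hf. rewrite !norm2_norm_sq.
    rewrite (proj2 (J_H2_isometry _ (HH f Hf))).
    rewrite wcomp_isometry by auto using Cmod_1. reflexivity.
  - intros f Hf z Hz.
    rewrite J_wcomp by auto using Cmod_1.
    rewrite <- Elp, Cconj_1.
    transitivity (wcomp (kern (lambda * p) 1) (mobius (lambda * p) (Cconj lambda))
                    (wcomp (kern p 1) (mobius p lambda) f) z).
    + apply wcomp_eqD; [now rewrite Cmod_mult, Hl, Rmult_1_l
                       |now rewrite Cmod_conj| |exact Hz].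
      intros w Hw. unfold sharp. rewrite J_sharp by auto using in_disk_conj.
      unfold sharp. now rewrite !Cconj_conj.
    + pose proof (wcomp_inverse_l p lambda 1 f Hp Hl Cmod_1 z Hz) as H.
      now rewrite Cconj_1 in H.
Qed.

(** For [T] with parameters [q], [mu], [c], both [W T] and [T^-1 (J W J)] are
    rotations by [kern_mobius_comp], and [J] carries the rotation [W T] to the
    other one. *)
Lemma wcomp_J_symmetry (q mu c lambda : C) (f : C -> C) :
  (Cmod q < 1)%R -> Cmod mu = 1%R -> Cmod c = 1%R -> Cmod lambda = 1%R ->
  lambda * Cconj q = q -> H2 f ->
  let W := wcomp (kern (Cconj q) 1) (mobius (Cconj q) lambda) in
  eqD (J (W (wcomp (kern q c) (mobius q mu) f)))
    (wcomp (kern (mu * q) (Cconj c)) (mobius (mu * q) (Cconj mu)) (J (W f))).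
Proof.
  intros Hq Hmu Hc Hl El Hf W z Hz.
  assert (Hq' : (Cmod (Cconj q) < 1)%R) by now rewrite Cmod_conj.
  assert (Hmq : (Cmod (mu * q) < 1)%R) by now rewrite Cmod_mult, Hmu, Rmult_1_l.
  transitivity (Cconj c * sharp f (Cconj lambda * Cconj mu * z)).
  - rewrite J_sharp; [| |exact Hz].
    2:{ apply wcomp_H2_contraction; auto using Cmod_1. now apply wcomp_H2_contraction. }
    pose proof (kern_mobius_comp (Cconj q) mu lambda 1 c f (Cconj z)
                  Hq' Hl (in_disk_conj z Hz)) as H.
    rewrite El in H. unfold sharp, W. rewrite H.
    rewrite Cmult_1_l, !Cmult_conj, !Cconj_conj.
    now rewrite (Cmult_comm mu).
  - rewrite (wcomp_eqD (mu * q) (Cconj mu) (Cconj c) _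
       (wcomp (kern q 1) (mobius q (Cconj lambda)) (sharp f)) Hmq); [| | |exact Hz].
    + pose proof (kern_mobius_comp (mu * q) (Cconj lambda) (Cconj mu) (Cconj c) 1
                    (sharp f) z Hmq ltac:(now rewrite Cmod_conj) Hz) as H.
      rewrite Cmult_assoc, (Cmult_comm (Cconj mu)), (conj_unimodular mu Hmu),
        Cmult_1_l, Cmult_1_r in H.
      now rewrite H.
    + now rewrite Cmod_conj.
    + intros w Hw. unfold W. rewrite J_wcomp by auto using Cmod_1.
      now rewrite Cconj_conj, Cconj_1.
Qed.

(** * Holomorphy of linear fractional maps *)

Lemma ex_derive_of_quadratic_error (f : C -> C) (x l : C) (M d : R) :
  (0 < d)%R ->
  (forall y, (Cmod (y - x) < d)%R ->
     (Cmod (f y - f x - (y - x) * l) <= M * Cmod (y - x) ^ 2)%R) ->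
  @ex_derive C_AbsRing C_NormedModule f x.
Proof.
  intros Hd HM. exists l. split; [apply is_linear_scal_l|].
  intros x' Hx' eps.
  apply (@is_filter_lim_locally_unique C_AbsRing (AbsRing_NormedModule C_AbsRing)) in Hx'.
  subst x'.
  assert (He : (0 < Rmin d (eps / (Rabs M + 1)))%R).
  { apply Rmin_glb_lt; [exact Hd|].
    apply Rdiv_lt_0_compat; [apply cond_pos|]. pose proof (Rabs_pos M). lra. }
  exists (mkposreal _ He). intros y Hy.
  change (Cmod (y - x) < Rmin d (eps / (Rabs M + 1)))%R in Hy.
  change (Cmod (f y - f x - (y - x) * l) <= eps * Cmod (y - x))%R.
  pose proof (Rlt_le_trans _ _ _ Hy (Rmin_l _ _)) as H1.
  pose proof (Rlt_le_trans _ _ _ Hy (Rmin_r _ _)) as H2.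
  eapply Rle_trans; [apply (HM y H1)|].
  pose proof (Rabs_pos M) as HM0. pose proof (Rle_abs M) as HM1.
  apply Rlt_div_r in H2; [|lra].
  pose proof (Cmod_ge_0 (y - x)). nra.
Qed.

(** The difference quotient error of a linear fractional map is explicitly
    quadratic; on the disk [|1 - c y|] is at least [1 - |c|], which bounds the
    constant. *)
Lemma linear_fractional_holomorphic (a b c : C) :
  (Cmod c < 1)%R -> holomorphic_on_disk (fun z => (a + b * z) / (1 - c * z)).
Proof.
  intros Hc x Hx.
  pose proof (one_minus_neq_0 c x Hc Hx) as HDx.
  pose proof (Cmod_ge_0 c) as Hc0.
  apply ex_derive_of_quadratic_error
    with (l := (b + a * c) / ((1 - c * x) * (1 - c * x)))
         (d := (1 - Cmod x)%R)
         (M := (Cmod ((b + a * c) * c / ((1 - c * x) * (1 - c * x)))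
                * / (1 - Cmod c))%R).
  - unfold in_disk in Hx. lra.
  - intros y Hy.
    (* The radius [1 - |x|] keeps [y] inside the disk. *)
    assert (Hy1 : (Cmod y < 1)%R).
    { pose proof (Cmod_triangle (y - x) x) as T.
      replace (y - x + x) with y in T by ring. lra. }
    pose proof (one_minus_neq_0 c y Hc Hy1) as HDy.
    replace ((a + b * y) / (1 - c * y) - (a + b * x) / (1 - c * x)
             - (y - x) * ((b + a * c) / ((1 - c * x) * (1 - c * x))))
      with ((b + a * c) * c / ((1 - c * x) * (1 - c * x)) * / (1 - c * y)
            * ((y - x) * (y - x)))
      by (field; now split).
    rewrite !Cmod_mult.
    replace (Cmod (y - x) ^ 2)%R with (Cmod (y - x) * Cmod (y - x))%R by ring.
    apply Rmult_le_compat_r; [apply Rmult_le_pos; apply Cmod_ge_0|].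
    apply Rmult_le_compat_l; [apply Cmod_ge_0|].
    rewrite Cmod_inv by exact HDy. apply Rinv_le_contravar; [lra|].
    pose proof (Cmod_triangle (1 - c * y) (c * y)) as T.
    replace (1 - c * y + c * y) with (RtoC 1) in T by ring.
    rewrite Cmod_1, Cmod_mult in T.
    pose proof (Cmod_ge_0 y). nra.
Qed.

Lemma mobius_holomorphic (q mu : C) :
  (Cmod q < 1)%R -> holomorphic_on_disk (mobius q mu).
Proof.
  intros Hq.
  replace (mobius q mu)
    with (fun z => (mu * q + (- mu) * z) / (1 - Cconj q * z)).
  - apply linear_fractional_holomorphic. now rewrite Cmod_conj.
  - apply functional_extensionality. intros z. unfold mobius, Cdiv. ring.
Qed.

Lemma kern_holomorphic (q c : C) :
  (Cmod q < 1)%R -> holomorphic_on_disk (kern q c).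
Proof.
  intros Hq.
  replace (kern q c)
    with (fun z => (c * defect q + 0 * z) / (1 - Cconj q * z)).
  - apply linear_fractional_holomorphic. now rewrite Cmod_conj.
  - apply functional_extensionality. intros z. unfold kern, Cdiv. ring.
Qed.

Lemma mobius_self_map (q mu : C) :
  (Cmod q < 1)%R -> Cmod mu = 1%R -> holomorphic_self_map (mobius q mu).
Proof.
  intros Hq Hmu. split; [now apply mobius_holomorphic|].
  intros z Hz. now apply mobius_in_disk.
Qed.

(** * Complex symmetry with conjugation [J W] *)

Theorem theorem2 (q mu1 mu2 lambda : C)
    (hq : (Cmod q < 1)%R) (hmu1 : Cmod mu1 = 1%R) (hmu2 : Cmod mu2 = 1%R)
    (hlambda : q <> RtoC 0 -> lambda = q / Cconj q)
    (hlambda0 : q = RtoC 0 -> Cmod lambda = 1%R) :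
  let phi := fun z : C => mu1 * ((q - z) / (1 - Cconj q * z)) in
  let psi := fun z : C =>
    mu2 * (RtoC (sqrt (1 - Cmod q ^ 2)) / (1 - Cconj q * z)) in
  let k := fun z : C => RtoC (sqrt (1 - Cmod q ^ 2)) / (1 - q * z) in
  let sigma := fun z : C => lambda * ((Cconj q - z) / (1 - q * z)) in
  holomorphic_self_map phi /\ holomorphic_on_disk psi /\
  holomorphic_self_map sigma /\ holomorphic_on_disk k /\
  unitary_operator (wcomp psi phi) /\
  bounded_operator (wcomp k sigma) /\
  complex_symmetric_with (wcomp psi phi) (fun f => J (wcomp k sigma f)).
Proof.
  intros phi psi k sigma.
  assert (Hq' : (Cmod (Cconj q) < 1)%R) by now rewrite Cmod_conj.
  (* These two facts hold for every [q] and are all that the symmetry uses, so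
     the case [q = 0] ends here. *)
  assert (Hl : Cmod lambda = 1%R /\ lambda * Cconj q = q).
  { destruct (Ceq_dec q 0) as [E|E].
    - split; [now apply hlambda0|]. rewrite E.
      unfold Cconj, Cmult, RtoC. simpl. f_equal; ring.
    - assert (E' : Cconj q <> 0).
      { apply Cmod_gt_0. rewrite Cmod_conj. now apply Cmod_gt_0. }
      rewrite (hlambda E). split; [|now field].
      rewrite Cmod_div, Cmod_conj by exact E'. field.
      apply Cmod_gt_0 in E. lra. }
  destruct Hl as [Hl El].
  change phi with (mobius q mu1). change psi with (kern q mu2).
  assert (Ek : k = kern (Cconj q) 1).
  { apply functional_extensionality. intros z. unfold k, kern, defect.
    now rewrite Cconj_conj, Cmod_conj, Cmult_1_l. }
  assert (Es : sigma = mobius (Cconj q) lambda).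
  { apply functional_extensionality. intros z. unfold sigma, mobius.
    now rewrite Cconj_conj. }
  rewrite Ek, Es.
  split; [now apply mobius_self_map|].
  split; [now apply kern_holomorphic|].
  split; [now apply mobius_self_map|].
  split; [now apply kern_holomorphic|].
  split; [now apply wcomp_unitary|].
  split; [apply wcomp_bounded; auto using Cmod_1|].
  split; [now apply wcomp_bounded|].
  split.
  - apply J_wcomp_conjugation; auto. now rewrite Cconj_conj.
  - eexists. split; [now apply wcomp_adjoint|].
    intros f Hf. now apply wcomp_J_symmetry.
Qed.
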